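(* Let $D$ be a diagram with $N$ crossings of an oriented knot $K\subset S^3$, and fix a choice of sign-types $\epsilon=(\epsilon_+,\epsilon_-)$. For any two indices $i,j\in\{1,\dots,N\}$, the $u$-polynomial $g_{ij}(u)$ at the pair of arcs $\mathsf a_i,\mathsf a_j$ is contained in $\mathbb Q[u]$.
   Context: Diagram conventions: $K$ is an oriented knot in $S^3$, $G_K=\pi_1(S^3\setminus K)$, and $D$ is an oriented diagram of $K$ with crossings $c_1,\dots,c_N$ and arcs $\mathsf a_1,\dots,\mathsf a_N$ (an arc is a connected piece of $D$ between two consecutive under-crossings). The Wirtinger generator of $\mathsf a_i$ is $m_i$. At a crossing with incoming under-arc $\mathsf a_i$, outgoing under-arc $\mathsf a_j$, over-arc $\mathsf a_k$, the Wirtinger relation is $m_j=m_k^{-1}m_im_k$ (positive crossing) or $m_j=m_km_im_k^{-1}$ (negative crossing). A parabolic representation is a non-abelian homomorphism $\rho:G_K\to SL_2(\mathbb C)$ with $\mathrm{tr}\,\rho(m)=2$, $\rho(m)\neq I$ for every meridian $m$. $X_{par}$ is the set of conjugacy classes of parabolic representations, viewed as an affine variety (character variety of parabolic representations). Let $X$ be the union of the zero-dimensional components of $X_{par}$, a finite set (if $X_{par}$ is zero-dimensional, $X=X_{par}$). For $b=\binom xy\in\mathbb C^2$ let $\mathcal M(b)=\begin{pmatrix}1-xy&x^2\\-y^2&1+xy\end{pmatrix}$; put $a\triangleright b=\mathcal M(b)^{-1}a$, $a\triangleleft b=\mathcal M(b)a$. An arc-coloring of sign-type $\epsilon\in\{\pm1\}^N$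 is $(a_1,\dots,a_N)\in(\mathbb C^2)^N$ such that at each crossing $c_n$ (with incoming under-arc $\mathsf a_i$, outgoing under-arc $\mathsf a_j$ and over-arc $\mathsf a_k$) $\epsilon_na_j=a_i\triangleright a_k$ if $c_n$ is positive and $\epsilon_na_j=a_i\triangleleft a_k$ if negative; its associated representation is given by $m_i\mapsto\mathcal M(a_i)$. The obstruction class of a parabolic $\rho$ is $\mathrm{ob}(\rho)=\tfrac12\mathrm{tr}\,\rho(\lambda)\in\{\pm1\}$, $\lambda$ a longitude. Fix two sign-types $\epsilon_+,\epsilon_-\in\{\pm1\}^N$ with product of entries $+1$ and $-1$ respectively. For each parabolic $\rho$ with $\mathrm{ob}(\rho)=\pm1$ there are exactly two arc-colorings of sign-type $\epsilon_\pm$ with associated representation $\rho$, of the form $a$ and $-a$. The $u$-value is $u_{ij}(\rho):=\det(a_i,a_j)$ (independent of the choice of $\pm a$ and of the representative in the conjugacy class). Definition: $g_{ij}(u):=\prod_{\rho\in X}(u-u_{ij}(\rho))$. *)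

(* Defs.v *)
From HB Require Import structures.
From mathcomp Require Import all_boot all_order all_fingroup all_algebra.
From mathcomp Require Import all_classical all_reals.
From mathcomp Require Import generic_quotient complex.

Set Implicit Arguments.
Unset Strict Implicit.
Unset Printing Implicit Defensive.

Import Order.TTheory GRing.Theory Num.Theory.

Local Open Scope classical_set_scope.
Local Open Scope quotient_scope.
Local Open Scope ring_scope.

(* The letter (x, true) stands for the generator x and (x, false) for its
   inverse. *)
Definition word (I : Type) := seq (I * bool).

Section Presentation.
Variables (I : choiceType) (r : word I -> word I -> Prop).

Inductive weq : word I -> word I -> Prop :=
| weq_rel u v : r u v -> weq u v
| weq_cancel x b : weq [:: (x, b); (x, ~~ b)] [::]
| weq_refl u : weq u u
| weq_sym u v : weq u v -> weq v u
| weq_trans u v w : weq u v -> weq v w -> weq u w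
| weq_cat u u' v v' : weq u u' -> weq v v' -> weq (u ++ v) (u' ++ v').

Definition weqb (u v : word I) : bool := `[< weq u v >].

Lemma weqb_refl : reflexive weqb.
Proof. by move=> u; apply/asboolP; exact: weq_refl. Qed.

Lemma weqb_sym : symmetric weqb.
Proof. by move=> u v; apply/asboolP/asboolP; exact: weq_sym. Qed.

Lemma weqb_trans : transitive weqb.
Proof.
move=> v u w /asboolP uv /asboolP vw; apply/asboolP.
exact: weq_trans uv vw.
Qed.

Canonical weqb_equiv := EquivRel weqb weqb_refl weqb_sym weqb_trans.

Definition presented := {eq_quot weqb_equiv}.
HB.instance Definition _ := Choice.on presented.
HB.instance Definition _ := EqQuotient.on presented.

Definition pclass (u : word I) : presented := \pi_presented u.

Lemma pclassP u v : pclass u = pclass v <-> weq u v.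
Proof.
by split=> [/eqmodP /asboolP | uv] //; apply/eqmodP/asboolP.
Qed.

Lemma pclass_repr (g : presented) : pclass (repr g) = g.
Proof. exact: reprK. Qed.

Lemma repr_pclass u : weq (repr (pclass u)) u.
Proof. by apply/pclassP; rewrite pclass_repr. Qed.

Definition winv (u : word I) : word I := rev [seq (x.1, ~~ x.2) | x <- u].

Lemma weq_winv u v : weq u v -> weq (winv u) (winv v).
Proof.
have wV w : weq (winv w ++ w) [::].
  elim: w => [|[x b] w IH]; first exact: weq_refl.
  rewrite /winv /= rev_cons -cats1 -catA.
  apply: weq_trans IH.
  apply: weq_cat; first exact: weq_refl.
  have := weq_cat (weq_cancel x (~~ b)) (weq_refl w).
  by rewrite negbK.
have winvK w : winv (winv w) = w.
  rewrite /winv map_rev revK -map_comp -[RHS]map_id.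
  by apply: eq_map => -[x b] /=; rewrite negbK.
move=> uv.
have h1 : weq (winv u) (winv u ++ (v ++ winv v)).
  rewrite -{1}[winv u]cats0; apply: weq_cat; first exact: weq_refl.
  by apply: weq_sym; have := wV (winv v); rewrite winvK.
apply: weq_trans h1 _; rewrite catA -[X in weq _ X]cat0s.
apply: weq_cat; last exact: weq_refl.
apply: weq_trans (wV u).
apply: weq_cat; [exact: weq_refl | exact: weq_sym].
Qed.

Definition pmul (g h : presented) := pclass (repr g ++ repr h).
Definition pinv (g : presented) := pclass (winv (repr g)).

Lemma pclass_cat u v : pmul (pclass u) (pclass v) = pclass (u ++ v).
Proof. by apply/pclassP/weq_cat; exact: repr_pclass. Qed.

Lemma pclass_winv u : pinv (pclass u) = pclass (winv u).
Proof. by apply/pclassP/weq_winv; exact: repr_pclass. Qed.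

Lemma pmulA : associative pmul.
Proof.
move=> g h k; rewrite -[g]pclass_repr -[h]pclass_repr -[k]pclass_repr.
by rewrite !pclass_cat catA.
Qed.

Lemma pmul1g : left_id (pclass [::]) pmul.
Proof. by move=> g; rewrite -[g]pclass_repr pclass_cat. Qed.

Lemma pmulg1 : right_id (pclass [::]) pmul.
Proof. by move=> g; rewrite -[g]pclass_repr pclass_cat cats0. Qed.

Lemma pmulVg : left_inverse (pclass [::]) pinv pmul.
Proof.
move=> g; rewrite -[g]pclass_repr pclass_winv pclass_cat; apply/pclassP.
elim: (repr g) => [|[x b] w IH]; first exact: weq_refl.
rewrite /winv /= rev_cons -cats1 -catA; apply: weq_trans IH.
apply: weq_cat; first exact: weq_refl.
by have := weq_cat (weq_cancel x (~~ b)) (weq_refl w); rewrite negbK.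
Qed.

Lemma pmulgV : right_inverse (pclass [::]) pinv pmul.
Proof.
move=> g; rewrite -[g]pclass_repr pclass_winv pclass_cat; apply/pclassP.
elim/last_ind: (repr g) => [|w [x b] IH]; first exact: weq_refl.
rewrite /winv map_rcons rev_rcons -cats1 -catA; apply: weq_trans IH.
apply: weq_cat; first exact: weq_refl.
exact: (weq_cat (weq_cancel x b) (weq_refl _)).
Qed.

HB.instance Definition _ :=
  isGroup.Build presented pmulA pmul1g pmulg1 pmulVg pmulgV.

Definition pgen (x : I) : presented := pclass [:: (x, true)].

End Presentation.

Section Darts.
Variable N : nat.

(* Following the orientation, the knot runs through each crossing c twice: over
   the visit (c, true) and under the visit (c, false). *)
Definition visit := ('I_N * bool)%type.

(* The half-edge (v, true) leaves the visit v and (v, false) arrives at it. *)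
Definition dart := (visit * bool)%type.

Variables (next : {perm visit}) (positive : 'I_N -> bool).

Definition dart_opp (d : dart) : dart :=
  let: (v, out) := d in
  if out then (next v, false) else ((next^-1)%g v, true).

(* The counterclockwise successor of a half-edge around its crossing.  With
   both strands pointing upwards, the over-strand of a positive crossing goes
   from south-west to north-east, so the half-edges are, counterclockwise,
   over-out, under-out, over-in, under-in; at a negative crossing the cyclic
   order is the opposite one. *)
Definition dart_rot (d : dart) : dart :=
  let: ((c, over), out) := d in
  ((c, ~~ over),
   if positive c then (if over then out else ~~ out)
   else (if over then ~~ out else out)).

Definition dart_face (d : dart) : dart := dart_rot (dart_opp d).

End Darts.

(* A signed Gauss code on N crossings, with a labelling of its N arcs.
   [next v] is the visit following v along the knot; [arc v] labels the arc
   containing the edge from v to [next v].  An arc is cut exactly at the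
   under-crossings.
   [planar] is Euler's formula N - 2N + F = 2 for the connected 4-valent map
   drawn by the code: the code is that of a diagram in the sphere. *)
Record knot_diagram (N : nat) := KnotDiagram {
  next : {perm visit N};
  positive : 'I_N -> bool;
  arc : visit N -> 'I_N;
  one_component : forall v w : visit N, w \in porbit next v;
  planar : fcard (dart_face next positive) predT = (N + 2)%N;
  arc_over : forall c, arc (c, true) = arc ((next^-1)%g (c, true));
  arc_under_inj : injective (fun c => arc (c, false))
}.

Section Diagram.
Variables (N : nat) (D : knot_diagram N).

Definition in_arc (c : 'I_N) : 'I_N := arc D (((next D)^-1)%g (c, false)).
Definition out_arc (c : 'I_N) : 'I_N := arc D (c, false).
Definition over_arc (c : 'I_N) : 'I_N := arc D (c, true).

(* The Wirtinger presentation of the fundamental group of the complement: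
   m_j = m_k^-1 m_i m_k at a positive and m_j = m_k m_i m_k^-1 at a negative
   crossing. *)
Inductive wirtinger_rel : word 'I_N -> word 'I_N -> Prop :=
| Wirtinger c : wirtinger_rel
    [:: (out_arc c, true)]
    [:: (over_arc c, ~~ positive D c); (in_arc c, true);
        (over_arc c, positive D c)].

Definition knot_group := presented wirtinger_rel.

Definition wirtinger_gen (i : 'I_N) : knot_group := pgen wirtinger_rel i.

Definition meridian (g : knot_group) : Prop :=
  exists i h, g = (wirtinger_gen i ^ h)%g.

(* The contribution of a visit to a parallel of the knot: conjugating by it turns
   the Wirtinger generator before the visit into the one after it. *)
Definition passage (v : visit N) : knot_group :=
  let: (c, over) := v in
  let m := wirtinger_gen (over_arc c) in
  if over then 1%g else if positive D c then m else m^-1%g.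

(* The preferred longitude that starts on the outgoing under-arc of c, runs once
   along the knot and is corrected by the writhe. *)
Definition longitude_from (c : 'I_N) : knot_group :=
  let m := wirtinger_gen (out_arc c) in
  (\prod_(1 <= k < N.*2.+1) passage (iter k (next D) (c, false))
     * m ^- #|[pred d | positive D d]| * m ^+ #|[pred d | ~~ positive D d]|)%g.

Definition longitude (g : knot_group) : Prop :=
  exists c h, g = (longitude_from c ^ h)%g.

End Diagram.

Section Representations.
Variables (R : realType) (N : nat) (D : knot_diagram N).
Local Notation C := R[i].
Local Notation G := (knot_group D).

Definition SL2_rep (rho : G -> 'M[C]_2) : Prop :=
  (forall g, \det (rho g) = 1) /\
  (forall g h, rho (g * h)%g = rho g *m rho h).

Definition parabolic (rho : G -> 'M[C]_2) : Prop :=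
  [/\ SL2_rep rho,
      exists g h, rho g *m rho h <> rho h *m rho g
    & forall m, meridian m -> \tr (rho m) = 2 /\ rho m <> 1%:M].

Definition conjugacy_class (rho : G -> 'M[C]_2) : set (G -> 'M[C]_2) :=
  [set rho' | exists2 P : 'M[C]_2, \det P = 1 &
                forall g, rho' g = P *m rho g *m invmx P].

Definition X_par : set (set (G -> 'M[C]_2)) :=
  conjugacy_class @` [set rho | parabolic rho].

(* The coordinate ring of the SL2-character variety is generated by the traces
   of the elements of the group. *)
Inductive regular_fun : ((G -> 'M[C]_2) -> C) -> Prop :=
| regular_trace g : regular_fun (fun rho => \tr (rho g))
| regular_const z : regular_fun (fun=> z)
| regular_add f1 f2 : regular_fun f1 -> regular_fun f2 ->
    regular_fun (fun rho => f1 rho + f2 rho)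
| regular_mul f1 f2 : regular_fun f1 -> regular_fun f2 ->
    regular_fun (fun rho => f1 rho * f2 rho).

Definition zariski_closed (Z : set (set (G -> 'M[C]_2))) : Prop :=
  exists2 F : set ((G -> 'M[C]_2) -> C), F `<=` regular_fun &
    Z = [set c | X_par c /\ forall f rho, F f -> c rho -> f rho = 0].

Definition irreducible_closed (Z : set (set (G -> 'M[C]_2))) : Prop :=
  [/\ zariski_closed Z, Z !=set0 &
      forall A B, zariski_closed A -> zariski_closed B ->
        Z `<=` A `|` B -> Z `<=` A \/ Z `<=` B].

Definition irreducible_component (Z : set (set (G -> 'M[C]_2))) : Prop :=
  irreducible_closed Z /\
  forall W, irreducible_closed W -> Z `<=` W -> W = Z.

(* For nonempty Z: Krull dimension 0, i.e., no chain of length 1 of irreducible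
   closed subsets. *)
Definition zero_dimensional (Z : set (set (G -> 'M[C]_2))) : Prop :=
  ~ exists W0 W1, [/\ irreducible_closed W0, irreducible_closed W1,
                      W0 `<` W1 & W1 `<=` Z].

Definition X_zero : set (set (G -> 'M[C]_2)) :=
  [set c | exists Z, [/\ irreducible_component Z, zero_dimensional Z & Z c]].

Definition color_mx (b : 'cV[C]_2) : 'M[C]_2 :=
  let x := b 0 0 in let y := b 1 0 in
  \matrix_(s, t) if s == 0 then (if t == 0 then 1 - x * y else x ^+ 2)
                 else (if t == 0 then - y ^+ 2 else 1 + x * y).

Definition qop (a b : 'cV[C]_2) : 'cV[C]_2 := invmx (color_mx b) *m a.
Definition qopV (a b : 'cV[C]_2) : 'cV[C]_2 := color_mx b *m a.

Definition arc_coloring (eps : 'I_N -> int) (a : 'I_N -> 'cV[C]_2) : Prop :=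
  forall c : 'I_N,
    (eps c)%:~R *: a (out_arc D c) =
      if positive D c then qop (a (in_arc D c)) (a (over_arc D c))
      else qopV (a (in_arc D c)) (a (over_arc D c)).

Definition associated (a : 'I_N -> 'cV[C]_2) (rho : G -> 'M[C]_2) : Prop :=
  forall k, rho (wirtinger_gen D k) = color_mx (a k).

Definition obstruction_class (rho : G -> 'M[C]_2) (e : C) : Prop :=
  exists2 l, longitude l & e = 2^-1 * \tr (rho l).

Definition is_u_value (eps_p eps_m : 'I_N -> int) (i j : 'I_N)
    (c : set (G -> 'M[C]_2)) (u : C) : Prop :=
  exists rho a,
    [/\ c rho, associated a rho,
        (obstruction_class rho 1 /\ arc_coloring eps_p a) \/
        (obstruction_class rho (-1) /\ arc_coloring eps_m a)
      & u = \det (row_mx (a i) (a j) : 'M[C]_2)].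

Definition u_value (eps_p eps_m : 'I_N -> int) (i j : 'I_N)
    (c : set (G -> 'M[C]_2)) : C :=
  xget 0 [set u | is_u_value eps_p eps_m i j c u].

(* X_zero is finite and no factor equals 1, so this finitely supported product
   runs over all of X_zero. *)
Definition u_polynomial (eps_p eps_m : 'I_N -> int) (i j : 'I_N) : {poly C} :=
  \big[*%R/1]_(c \in X_zero) ('X - (u_value eps_p eps_m i j c)%:P).

End Representations.

Definition sign_type (N : nat) (eps : 'I_N -> int) : Prop :=
  forall n, eps n = 1 \/ eps n = -1.

(* Main.v *)
(* A field automorphism s of C acts on representations entrywise.  Every notion
   entering the definition of X is invariant under this action, so s permutes X.
   The arc-colorings with a given associated representation are unique up to a
   global sign once the sign-type is fixed, and sign-types of different products
   exclude each other; hence u-values are well defined and commute with s, and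
   the u-polynomial is fixed by every automorphism of C.

   Every z outside Q is moved by some automorphism: if K is a subfield maximal
   among those avoiding z, then C is algebraic over K, z has a conjugate z' <> z
   over K, and by Zorn's lemma the isomorphism K(z) -> K(z') extends to C. *)
Require Import Defs.
From HB Require Import structures.
From mathcomp Require Import all_boot all_order all_fingroup all_algebra.
From mathcomp Require Import all_classical all_reals.
From mathcomp Require Import complex.
From mathcomp Require Import zify ring.

Set Implicit Arguments.
Unset Strict Implicit.
Unset Printing Implicit Defensive.

Import GRing.Theory Num.Theory.
Local Open Scope classical_set_scope.
Local Open Scope ring_scope.

(** * Automorphisms of an algebraically closed field *)

(** [Zorn_bigcup] also asks for the union of the empty chain. Applying it to the sets whose union
    with [A0] satisfies [P] turns that case into [P A0]. *)
Lemma Zorn_above (T : Type) (P : set (set T)) (A0 : set T) :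
  P A0 ->
  (forall F : set (set T), F !=set0 -> F `<=` P -> total_on F subset ->
     P (\bigcup_(X in F) X)) ->
  exists A, [/\ P A, A0 `<=` A & forall B, P B -> A `<=` B -> B = A].
Proof.
move=> PA0 Pcup.
have [F FP Ftot|A [PA Amax]] := @Zorn_bigcup T [set A | P (A0 `|` A)].
  have [->|F0] := eqVneq F set0; first by rewrite /= bigcup_set0 setU0.
  have -> : [set A | P (A0 `|` A)] (\bigcup_(X in F) X) =
            P (\bigcup_(Y in [set A0 `|` X | X in F]) Y).
    rewrite /=; congr P; rewrite bigcup_image /=.
    apply/seteqP; split=> [t [A0t|[X FX Xt]]|t [X FX [|]]].
    - by have /set0P[X FX] := F0; exists X => //; left.
    - by exists X => //; right.
    - by left.
    - by right; exists X.
  apply: Pcup; first by have /set0P[X FX] := F0; exists (A0 `|` X), X.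
    by move=> _ [X FX <-]; exact: FP.
  move=> _ _ [X FX <-] [Y FY <-].
  by have [XY|YX] := Ftot X Y FX FY; [left|right]; apply: setUS.
exists (A0 `|` A); split=> // B PB AB; apply/seteqP; split=> // t Bt.
apply: contrapT => nt; apply: (Amax B); last first.
  by rewrite /= setUidr// => s A0s; apply: AB; left.
by split=> [s As|/(_ _ Bt) At]; [apply: AB; right|apply: nt; right].
Qed.

Lemma total_on_bigcup2 (T : Type) (F : set (set T)) (x y : T) :
  total_on F subset -> (\bigcup_(X in F) X) x -> (\bigcup_(X in F) X) y ->
  exists Z, [/\ F Z, Z x & Z y].
Proof.
move=> Ftot [X FX Xx] [Y FY Yy].
by have [XY|YX] := Ftot X Y FX FY; [exists Y|exists X]; split=> //; auto.
Qed.

(* The graph of an isomorphism between two subfields of F. *)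
Record partial_iso (F : fieldType) (S : set (F * F)) : Prop := PartialIso {
  partial_iso1 : S (1, 1);
  partial_isoB : forall a b, S a -> S b -> S (a.1 - b.1, a.2 - b.2);
  partial_isoM : forall a b, S a -> S b -> S (a.1 / b.1, a.2 / b.2);
  partial_iso0 : forall a, S a -> (a.1 == 0) = (a.2 == 0)
}.

Section PartialIsoField.
Variables (F : fieldType) (S : set (F * F)) (Siso : partial_iso S).

Definition piso_pred : {pred F * F} := fun a => `[< S a >].

Lemma piso_divring : divring_closed piso_pred.
Proof.
split=> [|a b /asboolP Sa /asboolP Sb|a b /asboolP Sa /asboolP Sb].
- by apply/asboolP; exact: partial_iso1 Siso.
- by apply/asboolP; exact: partial_isoB Siso _ _ Sa Sb.
- apply/asboolP; have := partial_isoM Siso Sa Sb.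
  (* By [partial_iso0] the components of [b] vanish together or not at all, so the inverse in the
     product ring is componentwise. *)
  suff -> : b^-1 = (b.1^-1, b.2^-1) by [].
  case: b Sb => [b1 b2] /(partial_iso0 Siso) /=.
  have [-> /esym/eqP->|b1n /esym/negbT b2n] := eqVneq b1 0.
    by rewrite !invr0.
  by apply: mulr1_eq; congr pair; rewrite /= divff.
Qed.

HB.instance Definition _ :=
  GRing.isDivringClosed.Build (F * F)%type piso_pred piso_divring.

Record piso_field := PisoField { piso_val : F * F; _ : piso_val \in piso_pred }.
HB.instance Definition _ := [isSub for piso_val].
HB.instance Definition _ := [Choice of piso_field by <:].
HB.instance Definition _ :=
  [SubChoice_isSubComUnitRing of piso_field by <:].

Lemma piso_fieldP (a : piso_field) : a != 0 -> a \is a GRing.unit.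
Proof.
case: a => [[x y] Sxy] a0; have /asboolP/(partial_iso0 Siso)/= xy0 := Sxy.
have x0 : x != 0.
  apply: contraNneq a0 => x0; apply/eqP/val_inj; rewrite /= x0.
  by have /eqP-> : y == 0 by rewrite -xy0 x0.
have y0 : y != 0 by rewrite -xy0.
rewrite qualifE /=; apply/unitrP; exists (x^-1, y^-1).
by split; congr pair; rewrite /= ?mulVf ?divff.
Qed.
HB.instance Definition _ := GRing.ComUnitRing_isField.Build piso_field piso_fieldP.

(** [L] is [S] itself as a subring of [F * F], embedded by the two projections. This provides a
    coefficient field for polynomials over the domain of a partial isomorphism. *)
Lemma partial_iso_field :
  exists (L : fieldType) (f g : {rmorphism L -> F}),
    S = range (fun a => (f a, g a)).
Proof.
exists piso_field.
exists (fst \o val), (snd \o val).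
apply/seteqP; split=> [[x y] Sxy|_ [a _ <-]].
  have Sxy' : (x, y) \in piso_pred by apply/asboolP.
  by exists (PisoField Sxy').
by rewrite /= -surjective_pairing; apply/asboolP; exact: (valP a).
Qed.
End PartialIsoField.

(** * Simple algebraic extensions of a partial isomorphism *)

Section Extension.
Variables (F L : fieldType) (f g : {rmorphism L -> F}).

Lemma algebraic_minpoly w : algebraicOver f w ->
  exists p : {poly L}, [/\ p != 0, root (map_poly f p) w &
    forall q, root (map_poly f q) w -> p %| q].
Proof.
move=> [p0 p0n p0w].
pose P n := `[< exists p : {poly L},
  [/\ p != 0, root (map_poly f p) w & size p = n] >].
have exP : exists n, P n by exists (size p0); apply/asboolP; exists p0.
have [n /asboolP[p [pn pw szp]] nmin] := ex_minnP exP.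
exists p; split=> // q qw; rewrite /dvdp; apply: contraTT (ltn_modpN0 q pn) => rn.
rewrite -leqNgt szp; apply: nmin; apply/asboolP; exists (q %% p); split=> //.
move: qw; rewrite [q in map_poly f q](divp_eq q p) rmorphD rmorphM /=.
by rewrite !rootE hornerD hornerM (eqP pw) mulr0 add0r.
Qed.

(** For roots [w] and [w'] of corresponding minimal polynomials, this is the graph of the
    isomorphism from f(L)(w) to g(L)(w') sending [w] to [w']. Polynomial values already form a
    field, since [w] is algebraic. *)
Definition adjoin (w w' : F) : set (F * F) :=
  range (fun q : {poly L} => ((map_poly f q).[w], (map_poly g q).[w'])).

Lemma adjoin_iso p w w' : p != 0 -> root (map_poly f p) w ->
  (forall q, root (map_poly f q) w -> p %| q) ->
  root (map_poly g p) w' -> partial_iso (adjoin w w').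
Proof.
move=> pn pw pmin pw'.
have inv q : ~~ root (map_poly f q) w -> exists r,
    (map_poly f r).[w] * (map_poly f q).[w] = 1 /\
    (map_poly g r).[w'] * (map_poly g q).[w'] = 1.
  move=> qw; have /Bezout_eq1_coprimepP[[u v] /= uv] : coprimep p q.
    (* With [p = e * d] and [d] dividing [q], the factor [e] vanishes at [w]; minimality gives it
       the full degree of [p], so [d] is constant. *)
    apply/coprimepP => d /dvdpP[e pE] /dvdpP[h qE].
    have /andP[en dn] : (e != 0) && (d != 0) by rewrite -negb_or -mulf_eq0 -pE.
    have dw : ~~ root (map_poly f d) w.
      by apply: contra qw => dw; rewrite qE rmorphM rootM dw orbT.
    have /pmin/(dvdp_leq en) : root (map_poly f e) w.
      by move: pw; rewrite pE rmorphM rootM (negPf dw) orbF.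
    rewrite pE size_mul// -size_poly_eq1 => le.
    have := size_poly_gt0 d; rewrite dn => d0.
    have := size_poly_gt0 e; rewrite en => e0.
    by apply/eqP; lia.
  exists v; have /(congr1 (fun s => (map_poly f s).[w])) := uv.
  have /(congr1 (fun s => (map_poly g s).[w'])) := uv.
  rewrite !rmorphD !rmorphM !rmorph1 /= !hornerE.
  by rewrite (eqP pw) (eqP pw') !mulr0 !add0r.
have root2 q : root (map_poly f q) w -> root (map_poly g q) w'.
  move/pmin/dvdpP=> [r ->]; rewrite rmorphM rootM.
  by rewrite pw' orbT.
split.
- by exists 1; rewrite // !rmorph1 !hornerC.
- by move=> _ _ [q _ <-] [r _ <-]; exists (q - r); rewrite //= !rmorphB /= !hornerE.
- move=> _ _ [q _ <-] [r _ <-] /=.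
  have [rw|/inv[s [sw sw']]] := boolP (root (map_poly f r) w).
    (* The quotient by 0 is 0 by convention, in both components thanks to [root2]. *)
    exists 0 => //; rewrite !rmorph0 !horner0.
    by rewrite (eqP rw) (eqP (root2 _ rw)) !invr0 !mulr0.
  exists (q * s); rewrite // !rmorphM /= !hornerM.
  rewrite (mulr1_eq (etrans (mulrC _ _) sw)).
  by rewrite (mulr1_eq (etrans (mulrC _ _) sw')).
- move=> _ [q _ <-] /=; apply/idP/idP => [/root2//|].
  apply: contraTT => /inv[s [_ sw']]; apply: contra_eqN sw' => /eqP->.
  by rewrite mulr0 eq_sym oner_eq0.
Qed.

Lemma adjoin_sub w w' : range (fun a => (f a, g a)) `<=` adjoin w w'.
Proof. by move=> _ [a _ <-]; exists a%:P; rewrite // !map_polyC !hornerC. Qed.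

Lemma adjoin_mem w w' : adjoin w w' (w, w').
Proof. by exists 'X; rewrite // !map_polyX !hornerX. Qed.

End Extension.

Lemma partial_iso_bigcup (F : fieldType) (C : set (set (F * F))) :
  C !=set0 -> C `<=` @partial_iso F -> total_on C subset ->
  partial_iso (\bigcup_(S in C) S).
Proof.
move=> [S0 CS0] Ciso Ctot; split.
- by exists S0 => //; exact: partial_iso1 (Ciso _ CS0).
- move=> a b Ca Cb; have [S [CS Sa Sb]] := total_on_bigcup2 Ctot Ca Cb.
  by exists S => //; exact: partial_isoB (Ciso _ CS) _ _ Sa Sb.
- move=> a b Ca Cb; have [S [CS Sa Sb]] := total_on_bigcup2 Ctot Ca Cb.
  by exists S => //; exact: partial_isoM (Ciso _ CS) _ _ Sa Sb.
- by move=> a [S CS Sa]; exact: partial_iso0 (Ciso _ CS) _ Sa.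
Qed.

Lemma algebraicOver_range (F K L : fieldType) (f0 : {rmorphism K -> F})
    (f : {rmorphism L -> F}) w :
  range f0 `<=` range f -> algebraicOver f0 w -> algebraicOver f w.
Proof.
move=> f0f [p pn pw].
have /choice[h hE] : forall a, exists b, f b = f0 a.
  by move=> a; have [|b _ <-] := f0f (f0 a); [exists a | exists b].
(* This makes [map_poly h] act coefficientwise. *)
have h0 : h 0 = 0 by apply: (fmorph_inj f); rewrite hE !rmorph0.
have fh : map_poly f (map_poly h p) = map_poly f0 p.
  by apply/polyP => i; rewrite coef_map /= coef_map_id0 // coef_map hE.
by exists (map_poly h p); rewrite ?fh // -(map_poly_eq0 f) fh map_poly_eq0.
Qed.

Definition swap_graph (F : Type) (S : set (F * F)) := [set a | S (a.2, a.1)].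

Lemma swap_graph_iso (F : fieldType) (S : set (F * F)) :
  partial_iso S -> partial_iso (swap_graph S).
Proof.
move=> Siso; split=> [|a b Sa Sb|a b Sa Sb|a Sa].
- exact: partial_iso1 Siso.
- exact: partial_isoB Siso _ _ Sa Sb.
- exact: partial_isoM Siso _ _ Sa Sb.
- by rewrite -(partial_iso0 Siso Sa).
Qed.

(** * Extension of partial isomorphisms to automorphisms *)

Section Automorphism.
Variables (F : closedFieldType) (K : fieldType) (f0 : {rmorphism K -> F}).
Hypothesis alg : forall w, algebraicOver f0 w.

(** The minimal polynomial of [w] over the domain, transported by [S], has a root [w'] in the
    algebraically closed [F]. Adjoining the pair extends [S], so by maximality the pair was already
    there. *)
Lemma maximal_partial_iso_total (S : set (F * F)) :
  partial_iso S -> (forall a, S (f0 a, f0 a)) ->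
  (forall S', partial_iso S' -> S `<=` S' -> S' = S) ->
  forall w, exists w', S (w, w').
Proof.
move=> Siso SK Smax w; have [L [f [g SE]]] := partial_iso_field Siso.
have [|p [pn pw pmin]] := @algebraic_minpoly _ _ f w.
  apply: (algebraicOver_range _ (alg w)) => _ [a _ <-].
  by have := SK a; rewrite SE => -[b _ [<- _]]; exists b.
have [w' pw'] : exists w', root (map_poly g p) w'.
  apply/closed_rootP; rewrite size_map_poly.
  rewrite -(size_map_poly f) neq_ltn (root_size_gt1 _ pw) ?orbT//.
  by rewrite map_poly_eq0.
exists w'; rewrite -(Smax _ (adjoin_iso pn pw pmin pw')); first exact: adjoin_mem.
by rewrite SE; exact: adjoin_sub.
Qed.

Lemma extend_partial_iso (S : set (F * F)) :
  partial_iso S -> (forall a, S (f0 a, f0 a)) ->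
  exists2 s : {rmorphism F -> F}, bijective s & forall a, S a -> s a.1 = a.2.
Proof.
move=> Siso SK.
have [M [Miso SM Mmax]] := Zorn_above Siso (@partial_iso_bigcup F).
have MK a : M (f0 a, f0 a) by apply: SM.
have /choice[s sM] := maximal_partial_iso_total Miso MK Mmax.
(* The inverse graph is maximal too, whence surjectivity. *)
have Mswap S' : partial_iso S' -> swap_graph M `<=` S' -> S' = swap_graph M.
  move=> S'iso MS'; rewrite -(Mmax _ (swap_graph_iso S'iso)).
    by apply/seteqP; split=> -[].
  by move=> [x y] Mxy; exact: MS'.
have /choice[t tM] : forall y, exists x, M (x, y).
  exact: maximal_partial_iso_total (swap_graph_iso Miso) MK Mswap.
have sE x y : M (x, y) -> s x = y.
  move=> Mxy; have := partial_iso0 Miso (partial_isoB Miso (sM x) Mxy).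
  by rewrite /= subrr eqxx => /esym; rewrite subr_eq0 => /eqP.
have tE x y : M (x, y) -> t y = x.
  move=> Mxy; have := partial_iso0 Miso (partial_isoB Miso (tM y) Mxy).
  by rewrite /= subrr eqxx subr_eq0 => /eqP.
have sB : zmod_morphism s.
  by move=> x y; apply/sE/(partial_isoB Miso (sM x) (sM y)).
have s1 : s 1 = 1 by apply/sE/(partial_iso1 Miso).
(* Partial isomorphisms are closed under division, so products are obtained as quotients by
   inverses. *)
have sV x : s x^-1 = (s x)^-1.
  rewrite -[x^-1]mul1r -[RHS]mul1r -{2}s1.
  exact/sE/(partial_isoM Miso (sM 1) (sM x)).
have sm : monoid_morphism s.
  split=> // x y; rewrite -{1}[y]invrK.
  by rewrite -[s y]invrK -sV; apply/sE/(partial_isoM Miso (sM x) (sM y^-1)).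
pose s' : {rmorphism F -> F} := HB.pack s
  (GRing.isZmodMorphism.Build _ _ s sB) (GRing.isMonoidMorphism.Build _ _ s sm).
exists s'; first by exists t => x; [apply: tE; exact: sM | apply: sE; exact: tM].
by move=> [x y] /SM; exact: sE.
Qed.

End Automorphism.

(** * Subfields maximal among those avoiding a given element *)

Lemma size_comp_sqr (R : idomainType) (p : {poly R}) :
  p != 0 -> size (p \Po 'X^2) = ((size p).-1.*2).+1.
Proof.
move=> pn; have : p \Po 'X^2 != 0.
  by rewrite comp_poly_eq0 ?size_polyXn.
rewrite -size_poly_gt0 => s0; have := size_comp_poly p 'X^2.
by rewrite size_polyXn muln2 => <-; rewrite prednK.
Qed.

Section Avoiding.
Variables (F : closedFieldType) (L : fieldType) (f : {rmorphism L -> F}) (z : F).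
Hypothesis zL : ~ range f z.
(* The image of L is maximal among the subfields avoiding z; a subfield is
   encoded by its diagonal. *)
Hypothesis Lmax : forall S, partial_iso S -> (forall a, S a -> a.1 = a.2) ->
  (forall a, S (f a, f a)) -> ~ S (z, z) -> forall x, S (x, x) -> range f x.

(** The field L(w), whose diagonal is [S], strictly contains the image of [L], so by maximality it
    contains [z]; hence z = p(w)/q(w). *)
Lemma adjoin_avoided w : ~ range f w ->
  exists p q : {poly L}, (map_poly f q).[w] != 0 /\
    z * (map_poly f q).[w] = (map_poly f p).[w].
Proof.
move=> wL; pose ev p := (map_poly f p).[w].
have ev1 : ev 1 = 1 by rewrite /ev rmorph1 hornerC.
have ev0 : ev 0 = 0 by rewrite /ev rmorph0 horner0.
have evM p q : ev (p * q) = ev p * ev q by rewrite /ev rmorphM hornerM.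
have evB p q : ev (p - q) = ev p - ev q by rewrite /ev rmorphB !hornerE.
have evC a : ev a%:P = f a by rewrite /ev map_polyC hornerC.
pose S : set (F * F) := [set a | a.1 = a.2 /\
  exists p q, ev q != 0 /\ a.1 = ev p / ev q].
have Siso : partial_iso S.
  split=> [|[x x'] [y y'] /= [/= <- [p [q [qn ->]]]] [/= <- [r [s [sn ->]]]]
           |[x x'] [y y'] /= [/= <- [p [q [qn ->]]]] [/= <- [r [s [sn ->]]]]
           |[x x'] [/= -> _]//].
  - split=> //; exists 1, 1; rewrite ev1 divr1; split=> //; exact: oner_neq0.
  - split=> //; exists (p * s - r * q), (q * s).
    by rewrite evB !evM mulf_neq0 //; split=> //=; field; rewrite qn sn.
  - split=> //; have [r0|rn] := eqVneq (ev r) 0.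
      exists 0, 1; rewrite ev0 ev1 /= r0 !mul0r invr0 mulr0.
      by split=> //; exact: oner_neq0.
    exists (p * s), (q * r); rewrite !evM mulf_neq0 //; split=> //=; field.
    by rewrite qn sn rn.
apply: contrapT => nz; apply: wL; apply: (Lmax Siso) => [a []//|a||].
- split=> //; exists a%:P, 1; rewrite ev1 evC divr1; split=> //; exact: oner_neq0.
- move=> [_ [p [q [qn /= zE]]]]; apply: nz; exists p, q; split=> //.
  by rewrite zE mulrVK // unitfE.
- split=> //; exists 'X, 1; rewrite ev1 divr1 /ev map_polyX hornerX.
  split=> //; exact: oner_neq0.
Qed.

(* If z were transcendental over L, then z would not lie in L(z^2), by parity of
   degrees. *)
Lemma algebraic_avoided : algebraicOver f z.
Proof.
have [[a _ az]|nz2] := pselect (range f (z ^+ 2)).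
  exists ('X^2 - a%:P); first by rewrite -size_poly_gt0 size_XnsubC.
  rewrite rmorphB /= map_polyXn map_polyC rootE !hornerE /=.
  by rewrite -[X in X - _]az subrr.
have [p [q [qn zE]]] := adjoin_avoided nz2.
have q0 : q != 0 by apply: contraNneq qn => ->; rewrite rmorph0 horner0.
(* Here [zE] reads z q(z^2) = p(z^2). The first term has odd degree and the second even degree or is
   0, so the difference is not 0. *)
exists ('X * (q \Po 'X^2) - (p \Po 'X^2)).
  have q20 : q \Po 'X^2 != 0 by rewrite -size_poly_gt0 size_comp_sqr.
  rewrite subr_eq0; apply/negP => /eqP /(congr1 (fun r : {poly L} => size r)).
  rewrite mulrC size_mulX // size_comp_sqr //.
  have [->|pn] := eqVneq p 0; first by rewrite comp_poly0 size_poly0.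
  by rewrite size_comp_sqr //; lia.
rewrite rmorphB rmorphM /= map_polyX !map_comp_poly map_polyXn rootE.
by rewrite !hornerE /= !horner_comp !hornerXn zE subrr.
Qed.

(** For [w] outside [L], clearing denominators in z = p(w)/q(w) makes [w] a root of [z q - p]. Its
    coefficients are algebraic over [L] because [z] is, and integrality is transitive. *)
Lemma algebraic_over_avoiding w : algebraicOver f w.
Proof.
have [[a _ <-]|/adjoin_avoided[p [q [qn zE]]]] := pselect (range f w).
  exact: algebraic_id.
apply/integral_algebraic.
pose r := z *: map_poly f q - map_poly f p.
have rw : root r w by rewrite rootE !hornerE zE subrr.
have q0 : q != 0 by apply: contraNneq qn => ->; rewrite rmorph0 horner0.
apply: (@integral_root _ _ _ r) => //.
  (* If [r] were 0, comparing coefficients at the degree of [q] would put [z] in the image of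
     [L]. *)
  apply: contra_notN zL => /eqP/(congr1 (fun s : {poly F} => s`_(size q).-1)).
  rewrite coefB coefZ !coef_map coef0 /= => /eqP; rewrite subr_eq0 => /eqP zq.
  have ln : lead_coef q != 0 by rewrite lead_coef_eq0.
  exists (p`_(size q).-1 / lead_coef q) => //.
  by rewrite fmorph_div -zq mulfK // fmorph_eq0.
apply/integral_poly => i; rewrite coefB coefZ !coef_map /=.
apply: integral_sub; last exact: integral_id.
apply: integral_mul; last exact: integral_id.
by apply/integral_algebraic; exact: algebraic_avoided.
Qed.

End Avoiding.

(** * The fixed field of all automorphisms is the field of rationals *)

Lemma range_partial_iso (F L : fieldType) (f g : {rmorphism L -> F}) :
  partial_iso (range (fun a => (f a, g a))).
Proof.
split=> [|_ _ [a _ <-] [b _ <-]|_ _ [a _ <-] [b _ <-]|_ [a _ <-]] /=.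
- by exists 1; rewrite ?rmorph1.
- by exists (a - b); rewrite ?rmorphB.
- by exists (a / b); rewrite ?fmorph_div.
- by rewrite !fmorph_eq0.
Qed.

Lemma other_root (F : numClosedFieldType) (L : fieldType)
    (f : {rmorphism L -> F}) (p : {poly L}) z :
  ~ range f z -> p != 0 -> root (map_poly f p) z ->
  (forall q, root (map_poly f q) z -> p %| q) ->
  exists2 z', root (map_poly f p) z' & z' != z.
Proof.
move=> zL pn pz pmin; have /factor_theorem[h pE] := pz.
have fpn : map_poly f p != 0 by rewrite map_poly_eq0.
have hn : h != 0 by apply: contraNneq fpn => h0; rewrite pE h0 mul0r.
have sz : size p = (size h).+1.
  by rewrite -(size_map_poly f) pE size_Mmonic ?monicXsubC // size_XsubC addn2.
have [h1|/closed_rootP[z' hz']] := eqVneq (size h) 1.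
  case: zL; have p1 : p`_1 != 0.
    by move: pn; rewrite -lead_coef_eq0 lead_coefE sz h1.
  exists (- p`_0 / p`_1) => //.
  have := pz; rewrite rootE horner_coef size_map_poly sz h1 !big_ord_recl big_ord0.
  rewrite !coef_map /= expr0 mulr1 expr1 addr0 => /eqP fp0.
  apply: (mulIf (_ : f p`_1 != 0)); first by rewrite fmorph_eq0.
  rewrite fmorph_div rmorphN divfK ?fmorph_eq0 //; apply/eqP.
  by rewrite eqr_oppLR -addr_eq0 mulrC -{}fp0 addrC.
exists z'; first by rewrite pE rootM hz'.
apply/eqP => zz'; move: hz'; rewrite zz' => hz.
have /pmin/dvdp_leq : root (map_poly f p^`()) z.
  rewrite -deriv_map pE derivM rootE !hornerE (eqP hz).
  by rewrite mul0r subrr mulr0 addr0.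
have dn : p^`() != 0.
  apply: contraNneq (pn) => /(congr1 (fun q : {poly L} => f q`_(size p).-2)).
  rewrite coef_deriv coef0 rmorph0 rmorphMn -lead_coef_eq0 lead_coefE sz /=.
  have := hn; rewrite -size_poly_gt0; case: (size h) => // n _ /= /eqP.
  by rewrite mulrn_eq0 /= fmorph_eq0.
by move/(_ dn); rewrite leqNgt lt_size_deriv.
Qed.

Lemma moving_automorphism (F : numClosedFieldType) (z : F) :
  ~ range (ratr : rat -> F) z ->
  exists2 s : {rmorphism F -> F}, bijective s & s z != z.
Proof.
move=> zQ.
(* Subfields avoiding [z], each encoded by the graph of its identity map; the Zorn argument starts
   at the rationals. *)
pose P (S : set (F * F)) :=
  [/\ partial_iso S, forall a, S a -> a.1 = a.2 & ~ S (z, z)].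
have [||S [[Siso Sdiag Sz] _ Smax]] :=
    @Zorn_above _ P (range (fun a : rat => (ratr a, ratr a))).
- split; first exact: range_partial_iso.
    by move=> _ [a _ <-].
  by move=> [a _ [az _]]; apply: zQ; exists a.
- move=> C C0 CP Ctot; split.
  + by apply: partial_iso_bigcup => // S /CP[].
  + by move=> a [S /CP[_ + _]]; apply.
  + by move=> [S /CP[_ _]].
have [L [f [g SE]]] := partial_iso_field Siso.
have fg : g =1 f by move=> a; apply/esym/(Sdiag (f a, g a)); rewrite SE; exists a.
have Sf a : S (f a, f a) by rewrite SE; exists a; rewrite // fg.
have zL : ~ range f z by move=> [a _ az]; apply: Sz; rewrite -az; exact: Sf.
have Lmax S' : partial_iso S' -> (forall a, S' a -> a.1 = a.2) ->
    (forall a, S' (f a, f a)) -> ~ S' (z, z) -> forall x, S' (x, x) -> range f x.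
  move=> S'iso S'diag S'f S'z x; rewrite (Smax S') //.
    by rewrite SE => -[a _ [<- _]]; exists a.
  by rewrite SE => _ [a _ <-]; rewrite fg.
have [p [pn pz pmin]] := algebraic_minpoly (algebraic_avoided Lmax).
have [z' pz' zz'] := other_root zL pn pz pmin.
have adjL a : adjoin f f z z' (f a, f a) by apply: adjoin_sub; exists a.
have [s sbij sE] := extend_partial_iso (algebraic_over_avoiding zL Lmax)
  (adjoin_iso pn pz pmin pz') adjL.
by exists s; rewrite // (sE _ (adjoin_mem f f z z')).
Qed.

Lemma fixed_poly_rational (F : numClosedFieldType) (p : {poly F}) :
  (forall s : {rmorphism F -> F}, bijective s -> map_poly s p = p) ->
  exists q : {poly rat}, p = map_poly ratr q.
Proof.
move=> pfix.
have /choice[c cE] : forall i, exists a : rat, ratr a = p`_i.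
  move=> i; apply: contrapT => pQ.
  have [|s sbij] := @moving_automorphism F p`_i.
    by move=> [a _ ap]; apply: pQ; exists a.
  by rewrite -coef_map /= pfix // eqxx.
exists (\poly_(i < size p) c i); apply/polyP => i; rewrite coef_map coef_poly.
by case: ltnP => [_|/(nth_default 0)->]; rewrite /= ?cE ?rmorph0.
Qed.

(** * The Galois action on parabolic representations *)

Definition rep_aut (C : nzRingType) (T : Type) (s : C -> C) (rho : T -> 'M[C]_2) :
  T -> 'M[C]_2 := fun g => map_mx s (rho g).

Definition class_aut (C : nzRingType) (T : Type) (s : C -> C)
  (c : set (T -> 'M[C]_2)) : set (T -> 'M[C]_2) := rep_aut s @` c.

Section GaloisAction.
Variables (R : realType) (N : nat) (D : knot_diagram N).
Local Notation C := R[i].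
Local Notation G := (knot_group D).
Variables (s t : {rmorphism C -> C}) (sK : cancel s t) (tK : cancel t s).

Lemma rep_autK : cancel (@rep_aut C G s) (rep_aut t).
Proof.
by move=> rho; apply/funext => g; apply/matrixP => i j; rewrite !mxE sK.
Qed.

Lemma class_autK : cancel (@class_aut C G s) (class_aut t).
Proof.
move=> c; rewrite /class_aut image_comp -[RHS]image_id.
by apply: eq_imagel => rho _; rewrite /= rep_autK.
Qed.

Lemma conjugacy_class_aut (rho : G -> 'M[C]_2) :
  class_aut s (conjugacy_class rho) = conjugacy_class (rep_aut s rho).
Proof.
apply/seteqP; split=> [_ [rho' [P P1 PE] <-]|rho' [P P1 PE]].
  exists (map_mx s P); first by rewrite det_map_mx P1 rmorph1.
  by move=> g; rewrite /rep_aut PE !map_mxM map_invmx.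
exists (rep_aut t rho').
  exists (map_mx t P); first by rewrite det_map_mx P1 rmorph1.
  move=> g; rewrite /rep_aut PE !map_mxM map_invmx.
  by have /(congr1 (@^~ g)) := rep_autK rho; rewrite /rep_aut => ->.
by apply/funext => g; apply/matrixP => i j; rewrite !mxE tK.
Qed.

Lemma parabolic_aut (rho : G -> 'M[C]_2) :
  parabolic rho -> parabolic (rep_aut s rho).
Proof.
move=> [[rho1 rhoM] [g [h gh]] rho_m]; split.
- by split=> [k|k l]; rewrite /rep_aut ?det_map_mx ?rho1 ?rmorph1 // rhoM map_mxM.
- exists g, h; rewrite /rep_aut -!map_mxM => /map_mx_inj; exact: gh.
- move=> m /rho_m[tr2 n1]; rewrite /rep_aut trace_map_mx tr2 rmorph_nat.
  by split=> //; rewrite -(map_mx1 s) => /map_mx_inj.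
Qed.

Lemma X_par_aut (c : set (G -> 'M[C]_2)) : X_par c -> X_par (class_aut s c).
Proof.
move=> [rho rho_par <-]; exists (rep_aut s rho); first exact: parabolic_aut.
by rewrite conjugacy_class_aut.
Qed.

(** The transport of [f] is semilinear: it fixes every trace function, since [s] undoes [t], and
    applies [s] to the constants. *)
Lemma regular_fun_aut (f : (G -> 'M[C]_2) -> C) :
  regular_fun f -> regular_fun (fun rho => s (f (rep_aut t rho))).
Proof.
elim=> [g|z|f1 f2 _ r1 _ r2|f1 f2 _ r1 _ r2].
- rewrite (_ : (fun _ => _) = fun rho : G -> 'M[C]_2 => \tr (rho g)).
    exact: regular_trace.
  by apply/funext => rho; rewrite /rep_aut trace_map_mx /= tK.
- exact: regular_const.
- under [X in regular_fun X]eq_fun do rewrite rmorphD.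
  exact: regular_add.
- under [X in regular_fun X]eq_fun do rewrite rmorphM.
  exact: regular_mul.
Qed.

End GaloisAction.

(** * Invariance of the zero-dimensional components *)

Section GaloisComponents.
Variables (R : realType) (N : nat) (D : knot_diagram N).
Local Notation C := R[i].
Local Notation G := (knot_group D).
Implicit Types (Z W : set (set (G -> 'M[C]_2))) (s t : {rmorphism C -> C}).

(** The transported equations cut out the image. Applied to [s] and to [t], this makes the action a
    homeomorphism of [X_par], from which irreducibility, components and dimension follow
    formally. *)
Lemma zariski_closed_aut s t Z : cancel s t -> cancel t s ->
  zariski_closed Z -> zariski_closed (class_aut s @` Z).
Proof.
move=> sK tK [F Freg ->].
exists ((fun f (rho : G -> 'M[C]_2) => s (f (rep_aut t rho))) @` F).
  by move=> _ [f /Freg f_reg <-]; exact: (regular_fun_aut tK).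
apply/seteqP; split=> [_ [c [c_par cF] <-]|c [c_par cF]].
  split=> [|_ _ [f Ff <-] [rho crho <-]]; first exact: X_par_aut sK tK _ c_par.
  by rewrite (rep_autK sK) (cF f rho) ?rmorph0.
exists (class_aut t c); last exact: class_autK tK _.
split=> [|f _ Ff [rho crho <-]]; first exact: X_par_aut tK sK _ c_par.
apply: (fmorph_inj s); rewrite rmorph0.
by apply: (cF (fun rho => s (f (rep_aut t rho)))) crho; exists f.
Qed.

Lemma image_class_autK s t Z : cancel s t ->
  class_aut t @` (class_aut s @` Z) = Z.
Proof.
move=> sK; rewrite image_comp -[RHS]image_id.
by apply: eq_imagel => c _; exact: class_autK sK c.
Qed.

Lemma irreducible_closed_aut s t Z : cancel s t -> cancel t s ->
  irreducible_closed Z -> irreducible_closed (class_aut s @` Z).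
Proof.
move=> sK tK [Zcl [c Zc] Zirr]; split.
- exact: zariski_closed_aut sK tK Zcl.
- by exists (class_aut s c), c.
- move=> A B Acl Bcl ZAB.
  have := Zirr _ _ (zariski_closed_aut tK sK Acl) (zariski_closed_aut tK sK Bcl).
  rewrite -image_setU -{1}(image_class_autK Z sK) => /(_ (image_subset _ ZAB)).
  rewrite -{2}(image_class_autK A tK) -{2}(image_class_autK B tK).
  by case=> ?; [left|right]; exact: image_subset.
Qed.

Lemma irreducible_component_aut s t Z : cancel s t -> cancel t s ->
  irreducible_component Z -> irreducible_component (class_aut s @` Z).
Proof.
move=> sK tK [Zirr Zmax]; split; first exact: irreducible_closed_aut sK tK Zirr.
move=> W Wirr ZW; rewrite -[W](image_class_autK W tK).
rewrite (Zmax _ (irreducible_closed_aut tK sK Wirr)) //.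
by rewrite -(image_class_autK Z sK); exact: image_subset.
Qed.

Lemma zero_dimensional_aut s t Z : cancel s t -> cancel t s ->
  zero_dimensional Z -> zero_dimensional (class_aut s @` Z).
Proof.
move=> sK tK Z0 [W0 [W1 [W0irr W1irr [W01 W10] W1Z]]]; apply: Z0.
exists (class_aut t @` W0), (class_aut t @` W1); split.
- exact: irreducible_closed_aut tK sK W0irr.
- exact: irreducible_closed_aut tK sK W1irr.
- split; first exact: image_subset.
  move=> W10'; apply: W10; rewrite -(image_class_autK W0 tK).
  by rewrite -(image_class_autK W1 tK); exact: image_subset.
- by rewrite -(image_class_autK Z sK); exact: image_subset.
Qed.

Lemma X_zero_aut s t (c : set (G -> 'M[C]_2)) : cancel s t -> cancel t s ->
  X_zero c -> X_zero (class_aut s c).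
Proof.
move=> sK tK [Z [Zcomp Z0 Zc]]; exists (class_aut s @` Z); split.
- exact: irreducible_component_aut sK tK Zcomp.
- exact: zero_dimensional_aut sK tK Z0.
- by exists c.
Qed.

Lemma X_zero_par (c : set (G -> 'M[C]_2)) : X_zero c -> X_par c.
Proof. by move=> [Z [[[[F _ ->] _ _] _] _ []]]. Qed.

End GaloisComponents.

(** * Arc-colorings and u-values *)

Section Colorings.
Variables (R : realType) (N : nat) (D : knot_diagram N).
Local Notation C := R[i].
Local Notation G := (knot_group D).
Implicit Types (a b : 'I_N -> 'cV[C]_2) (eps : 'I_N -> int).

Lemma color_mx_aut (s : {rmorphism C -> C}) (b : 'cV[C]_2) :
  color_mx (map_mx s b) = map_mx s (color_mx b).
Proof.
apply/matrixP => i j; rewrite !mxE.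
by case: ifP => _; case: ifP => _;
  rewrite ?(rmorphB, rmorphD, rmorphN, rmorph1, rmorphXn, rmorphM).
Qed.

(** [s] fixes the integers, hence the crossing signs and both obstruction classes, so the same
    sign-type applies after the action. *)
Lemma is_u_value_aut (s : {rmorphism C -> C}) eps_p eps_m i j
    (c : set (G -> 'M[C]_2)) u :
  is_u_value eps_p eps_m i j c u ->
  is_u_value eps_p eps_m i j (class_aut s c) (s u).
Proof.
move=> [rho [a [crho a_rho a_col ->]]].
have ob e : obstruction_class rho e -> obstruction_class (rep_aut s rho) (s e).
  move=> [l l_long ->]; exists l => //.
  by rewrite /rep_aut trace_map_mx rmorphM fmorphV rmorph_nat.
have col eps : arc_coloring D eps a -> arc_coloring D eps (fun k => map_mx s (a k)).
  move=> acol n; have := congr1 (map_mx s) (acol n).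
  rewrite map_mxZ rmorph_int => ->; rewrite /qop /qopV !color_mx_aut.
  by case: ifP => _; rewrite map_mxM ?map_invmx.
exists (rep_aut s rho), (fun k => map_mx s (a k)); split.
- by exists rho.
- by move=> k; rewrite color_mx_aut -a_rho.
- case: a_col => [[/ob + /col]|[/ob + /col]]; rewrite ?rmorphN rmorph1 => ? ?.
    by left.
  by right.
- by rewrite -map_row_mx det_map_mx.
Qed.

Lemma ord2_cases (i : 'I_2) : i = 0 \/ i = 1.
Proof. by case: i => [[|[|[]]] ?] //; [left|right]; exact: val_inj. Qed.

(** The matrix determines x^2, xy and y^2, hence (x, y) up to sign. The witness [e] is a quotient of
    nonzero coordinates, or 1 when [b] is 0. *)
Lemma color_mx_sign (a b : 'cV[C]_2) :
  color_mx a = color_mx b -> exists2 e : C, e ^+ 2 = 1 & a = e *: b.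
Proof.
move=> ab; have xy : a 0 0 * a 1 0 = b 0 0 * b 1 0.
  by have /matrixP/(_ 1 1) := ab; rewrite !mxE /=; exact: addrI.
have xx : a 0 0 ^+ 2 = b 0 0 ^+ 2 by have /matrixP/(_ 0 1) := ab; rewrite !mxE.
have yy : a 1 0 ^+ 2 = b 1 0 ^+ 2.
  by have /matrixP/(_ 1 0) := ab; rewrite !mxE /=; exact: oppr_inj.
have colP e : a 0 0 = e * b 0 0 -> a 1 0 = e * b 1 0 -> a = e *: b.
  move=> ax ay; apply/matrixP => i j; rewrite !mxE ord1.
  by have [->|->] := ord2_cases i.
have [x0|xn] := eqVneq (b 0 0) 0.
  have a0 : a 0 0 = 0 by apply/eqP; rewrite -sqrf_eq0 xx x0 expr0n.
  have [y0|yn] := eqVneq (b 1 0) 0.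
    exists 1; rewrite ?expr1n //; apply: colP; rewrite ?x0 ?y0 mulr0 //.
    by apply/eqP; rewrite -sqrf_eq0 yy y0 expr0n.
  exists (a 1 0 / b 1 0); first by rewrite expr_div_n yy divff ?expf_neq0.
  by apply: colP; rewrite ?divfK // x0 mulr0.
exists (a 0 0 / b 0 0); first by rewrite expr_div_n xx divff ?expf_neq0.
apply: colP; rewrite ?divfK //; apply: (mulfI xn).
have an : a 0 0 != 0 by rewrite -sqrf_eq0 xx sqrf_eq0.
apply: (mulfI an); rewrite mulrCA xy.
by transitivity (b 0 0 ^+ 2 * b 1 0); [ring | rewrite -xx; field].
Qed.

(** The linear form sending [c] to the determinant of (b, c); [color_mx b] is the transvection
    adding that multiple of [b]. *)
Definition symplectic_dual (b : 'cV[C]_2) : 'rV[C]_2 :=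
  \row_j (if j == 0 then - b 1 0 else b 0 0).

Lemma color_mxE (b : 'cV[C]_2) : color_mx b = 1%:M + b *m symplectic_dual b.
Proof.
apply/matrixP => i j; rewrite !mxE big_ord1 !mxE.
by have [->|->] := ord2_cases i; have [->|->] := ord2_cases j; rewrite /=; ring.
Qed.

Lemma mulmx22E (m n : nat) (A : 'M[C]_(m, 2)) (B : 'M[C]_(2, n)) i j :
  (A *m B) i j = A i 0 * B 0 j + A i 1 * B 1 j.
Proof.
rewrite !mxE big_ord_recl big_ord1.
by rewrite (_ : lift _ _ = 1 :> 'I_2) //; exact: val_inj.
Qed.

Lemma det_mx22 (A : 'M[C]_2) : \det A = A 0 0 * A 1 1 - A 0 1 * A 1 0.
Proof.
have l00 : lift ord0 ord0 = 1 :> 'I_2 by exact: val_inj.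
have l10 : lift 1 0 = 0 :> 'I_2 by exact: val_inj.
rewrite (expand_det_row _ 0) big_ord_recl big_ord1 /cofactor !det_mx11 !mxE.
by rewrite l00 l10 expr0 expr1 mul1r mulN1r mulrN.
Qed.

(** The identity det(Pb, Pc) = det(P) det(b, c), as an equality of linear forms in [c]. *)
Lemma symplectic_dual_mul (P : 'M[C]_2) (b : 'cV[C]_2) :
  symplectic_dual (P *m b) *m P = \det P *: symplectic_dual b.
Proof.
apply/matrixP => i j.
have sE (c : 'cV[C]_2) k l :
    symplectic_dual c k l = if l == 0 then - c 1 0 else c 0 0.
  by rewrite mxE.
rewrite [RHS]mxE det_mx22 mulmx22E !sE /= !mulmx22E.
by have [->|->] := ord2_cases j => /=; ring.
Qed.

Lemma color_mx_conj (P : 'M[C]_2) (b : 'cV[C]_2) : \det P = 1 ->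
  color_mx (P *m b) = P *m color_mx b *m invmx P.
Proof.
move=> P1; have Pu : P \in unitmx by rewrite unitmxE P1 unitr1.
apply: (can_inj (mulmxK Pu)); rewrite mulmxKV //.
rewrite !color_mxE mulmxDl mulmxDr mul1mx mulmx1.
by rewrite -[_ *m _ *m P]mulmxA symplectic_dual_mul P1 scale1r mulmxA.
Qed.

Lemma det_color_mx (b : 'cV[C]_2) : \det (color_mx b) = 1.
Proof. by rewrite det_mx22 !mxE /=; ring. Qed.

(** By [color_mx_conj], SL2 acts by automorphisms of the operations [qop] and [qopV]. *)
Lemma arc_coloring_conj (P : 'M[C]_2) eps a : \det P = 1 ->
  arc_coloring D eps a -> arc_coloring D eps (fun k => P *m a k).
Proof.
move=> P1 acol c; have Pu : P \in unitmx by rewrite unitmxE P1 unitr1.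
have Mu (b : 'cV[C]_2) : color_mx b \in unitmx.
  by rewrite unitmxE det_color_mx unitr1.
rewrite scalemxAr acol /qop /qopV; case: ifP => _; last first.
  by rewrite color_mx_conj // !mulmxA mulmxKV.
apply: (can_inj (mulKmx (Mu (P *m a (over_arc D c))))).
by rewrite mulKVmx // color_mx_conj // -!mulmxA mulKmx // mulKVmx.
Qed.

(* The two products agree over all visits, and their factors agree at the
   over-visits. *)
Lemma prod_in_arc (e : 'I_N -> C) : (forall k, e k != 0) ->
  \prod_c e (in_arc D c) = \prod_c e (out_arc D c).
Proof.
move=> en; have : \prod_v e (Defs.arc D v) =
                  \prod_v e (Defs.arc D (((Defs.next D)^-1)%g v)).
  by rewrite [LHS](reindex_inj (@perm_inj _ ((Defs.next D)^-1)%g)).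
have split_visits (f : visit N -> C) :
    \prod_v f v = \prod_c f (c, true) * \prod_c f (c, false).
  rewrite -big_split /=; transitivity (\prod_c \prod_over f (c, over)).
    by rewrite pair_bigA; apply: eq_bigr => -[].
  by apply: eq_bigr => c _; rewrite big_bool.
rewrite !split_visits; under eq_bigr do rewrite arc_over.
by move/mulfI => -> //; apply/prodf_neq0.
Qed.

(** * Comparison of two arc-colorings with the same matrices *)

Section TwoColorings.
Variables (eps eps' : 'I_N -> int) (a b : 'I_N -> 'cV[C]_2) (e : 'I_N -> C).
Hypotheses (acol : arc_coloring D eps a) (bcol : arc_coloring D eps' b).
Hypotheses (ab_mx : forall k, color_mx (a k) = color_mx (b k)).
Hypotheses (b0 : forall k, b k != 0) (abE : forall k, a k = e k *: b k).

(** The over-arc matrices agree, so both crossing equations compare multiples of the nonzero vector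
    [b (out_arc D c)]. *)
Lemma coloring_ratio c :
  (eps c)%:~R * e (out_arc D c) = (eps' c)%:~R * e (in_arc D c).
Proof.
have := acol c; rewrite /qop /qopV ab_mx !abE -!scalemxAr.
move: (bcol c); rewrite /qop /qopV.
case: ifP => _ <-; rewrite !scalerA => /eqP;
  rewrite -subr_eq0 -scalerBl scaler_eq0;
  by rewrite (negPf (b0 _)) orbF subr_eq0 [X in _ == X]mulrC => /eqP.
Qed.

(** In the product of [coloring_ratio] over all crossings, the ratios cancel by [prod_in_arc]. *)
Lemma coloring_sign_prod : (forall k, e k != 0) ->
  \prod_(c < N) eps c = \prod_(c < N) eps' c.
Proof.
move=> en; apply: (@intr_inj C); rewrite !rmorph_prod /=.
apply: (mulIf (_ : \prod_c e (out_arc D c) != 0)); first exact/prodf_neq0.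
rewrite -{2}prod_in_arc // -!big_split; apply: eq_bigr => c _.
exact: coloring_ratio.
Qed.

(** With equal signs the ratio is unchanged across each under-crossing. The knot is a single cycle
    of visits, and every label occurs on it because [arc_under_inj] is an injection of a finite set
    into itself. *)
Lemma coloring_ratio_const : sign_type eps -> eps = eps' ->
  forall k l, e k = e l.
Proof.
move=> eps1 eps'E; have e_io c : e (out_arc D c) = e (in_arc D c).
  apply: (mulfI _ (_ : _ = (eps c)%:~R * _)); last by rewrite coloring_ratio eps'E.
  by rewrite intr_eq0; case: (eps1 c) => ->.
have e_prev v : e (Defs.arc D (((Defs.next D)^-1)%g v)) = e (Defs.arc D v).
  by case: v => c []; [rewrite arc_over | exact/esym/e_io].
have e_arc v w : e (Defs.arc D w) = e (Defs.arc D v).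
  have /porbitP[n ->] := one_component D v w.
  elim: n => [|n IH]; first by rewrite expg0 perm1.
  by rewrite expgSr permM -e_prev permK.
have arcK k : exists v, k = Defs.arc D v.
  have /codomP[c cE] : k \in codom (fun c => Defs.arc D (c, false)).
    exact/(inj_card_onto (@arc_under_inj _ D)).
  by exists (c, false).
by move=> k l; have [v ->] := arcK k; have [w ->] := arcK l.
Qed.

End TwoColorings.

(** Conjugation brings both colorings over one representation. With equal sign-types they differ by
    a constant ratio of square 1, which disappears from the determinant; the mixed cases contradict
    the distinct sign products. *)
Lemma is_u_value_unique eps_p eps_m i j (c : set (G -> 'M[C]_2)) u u' :
  sign_type eps_p -> sign_type eps_m ->
  \prod_(n < N) eps_p n != \prod_(n < N) eps_m n -> X_par c ->
  is_u_value eps_p eps_m i j c u -> is_u_value eps_p eps_m i j c u' -> u = u'.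
Proof.
move=> p1 m1 pm [rho0 [_ _ rho0_mer] <-].
move=> [rho [a [[P P1 PE] arho acol ->]]].
move=> [rho' [a' [[P' P'1 P'E] arho' acol' ->]]].
have Pu : P \in unitmx by rewrite unitmxE P1 unitr1.
have P'u : P' \in unitmx by rewrite unitmxE P'1 unitr1.
pose Q := P' *m invmx P.
have Q1 : \det Q = 1 by rewrite det_mulmx det_inv P1 P'1 invr1 mulr1.
have Qu : Q \in unitmx by rewrite unitmxE Q1 unitr1.
have QE g : rho' g = Q *m rho g *m invmx Q.
  apply: (can_inj (mulmxK Qu)); rewrite mulmxKV // PE P'E /Q !mulmxA.
  by rewrite mulmxKV // mulmxKV.
pose b k := Q *m a k.
have ab_mx k : color_mx (a' k) = color_mx (b k).
  by rewrite -arho' QE arho color_mx_conj.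
(* A zero color would send a meridian to the identity, against parabolicity. *)
have a'0 k : a' k != 0.
  apply/eqP => a'k; have [|_ n1] := rho0_mer (wirtinger_gen D k).
    by exists k, 1%g; rewrite conjg1.
  apply: n1; have := P'E (wirtinger_gen D k).
  rewrite arho' a'k color_mxE mul0mx addr0.
  move=> /(congr1 (fun M => invmx P' *m M *m P')).
  by rewrite mulmx1 mulVmx // -!mulmxA mulKmx // mulVmx // mulmx1.
have /choice[e eE] : forall k, exists e : C, e ^+ 2 = 1 /\ a' k = e *: b k.
  by move=> k; have [e e1 ->] := color_mx_sign (ab_mx k); exists e.
have e1 k : e k ^+ 2 = 1 by case: (eE k).
have en k : e k != 0.
  by apply: contra_eq_neq (e1 k) => ->; rewrite expr0n eq_sym oner_neq0.
have abE k : a' k = e k *: b k by case: (eE k).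
have b0 k : b k != 0 by apply: contraNneq (a'0 k) => bk; rewrite abE bk scaler0.
have bcol eps : arc_coloring D eps a -> arc_coloring D eps b.
  exact: arc_coloring_conj.
have same eps : sign_type eps -> arc_coloring D eps a -> arc_coloring D eps a' ->
    \det (row_mx (a i) (a j) : 'M_2) = \det (row_mx (a' i) (a' j) : 'M_2).
  move=> eps1 /bcol bcol_eps a'col.
  have econst := coloring_ratio_const a'col bcol_eps ab_mx b0 abE eps1 erefl.
  rewrite !abE (econst j i) -scale_row_mx detZ e1 mul1r -mul_mx_row.
  by rewrite det_mulmx Q1 mul1r.
have differ eps eps' : arc_coloring D eps a -> arc_coloring D eps' a' ->
    \prod_(n < N) eps n = \prod_(n < N) eps' n.
  move=> /bcol bcol_eps a'col.
  exact/esym/(coloring_sign_prod a'col bcol_eps ab_mx b0 abE).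
case: acol acol' => -[_ acol] [] [_ acol'].
- exact: (same _ _ acol acol').
- by rewrite (differ _ _ acol acol') eqxx in pm.
- by rewrite (differ _ _ acol acol') eqxx in pm.
- exact: (same _ _ acol acol').
Qed.

End Colorings.

(** * Invariance of the u-polynomial *)

Section UPolynomial.
Variables (R : realType) (N : nat) (D : knot_diagram N).
Local Notation C := R[i].
Local Notation G := (knot_group D).
Variables (eps_p eps_m : 'I_N -> int) (i j : 'I_N).
Hypotheses (p1 : sign_type eps_p) (m1 : sign_type eps_m).
Hypothesis pm : \prod_(n < N) eps_p n != \prod_(n < N) eps_m n.
Variables (s t : {rmorphism C -> C}) (sK : cancel s t) (tK : cancel t s).

(** A class has a u-value exactly when its image has one, by transport along [s] and [t]; when there
    is none, the default 0 of [xget] is fixed by [s]. *)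
Lemma u_value_aut (c : set (G -> 'M[C]_2)) : X_par c ->
  u_value eps_p eps_m i j (class_aut s c) = s (u_value eps_p eps_m i j c).
Proof.
move=> c_par; rewrite /u_value.
case: xgetP => [u _ /= su|no_u]; case: xgetP => [u' _ /= u'c|no_u'].
- have sc_par := X_par_aut sK tK c_par.
  exact: is_u_value_unique p1 m1 pm sc_par su (is_u_value_aut s u'c).
- by have := is_u_value_aut t su; rewrite (class_autK sK) => /no_u'.
- by case: (no_u (s u')); exact: is_u_value_aut.
- by rewrite rmorph0.
Qed.

Lemma class_aut_bij :
  set_bij (@X_zero R N D) (@X_zero R N D) (class_aut s).
Proof.
split=> [c cX|c d _ _|c cX].
- exact: X_zero_aut sK tK cX.
- exact/can_inj/class_autK.
- exists (class_aut t c); first exact: X_zero_aut tK sK cX.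
  exact: class_autK.
Qed.

Lemma u_polynomial_aut :
  map_poly s (u_polynomial R D eps_p eps_m i j) =
  u_polynomial R D eps_p eps_m i j.
Proof.
(* If X_zero were infinite, the finitely supported product would be 1. *)
have [X_fin|X_inf] := pselect (finite_set (@X_zero R N D)); last first.
  rewrite /u_polynomial fsbig_dflt ?rmorph1 // setIidl //.
  move=> c _ /= /(congr1 (fun p : {poly C} => size p)).
  by rewrite size_XsubC size_poly1.
rewrite [RHS](reindex_fsbig (class_aut s) (@X_zero R N D)); last first.
  exact: class_aut_bij.
rewrite /u_polynomial !fsbig_finite // rmorph_prod /=.
apply: eq_big_seq => c; rewrite in_fset_set // inE => cX.
by rewrite map_polyXsubC u_value_aut //; exact: X_zero_par.
Qed.

End UPolynomial.

Theorem theorem4p12 (R : realType) (N : nat) (D : knot_diagram N)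
    (eps_p eps_m : 'I_N -> int)
    (eps_p_sign : sign_type eps_p) (eps_m_sign : sign_type eps_m)
    (eps_p_prod : \prod_(n < N) eps_p n = 1)
    (eps_m_prod : \prod_(n < N) eps_m n = -1)
    (i j : 'I_N) :
  exists p : {poly rat},
    u_polynomial R D eps_p eps_m i j = map_poly (ratr : rat -> R[i]) p.
Proof.
apply: fixed_poly_rational => s [t sK tK].
pose t' : {rmorphism R[i] -> R[i]} := HB.pack t
  (GRing.isZmodMorphism.Build _ _ t (can2_zmod_morphism sK tK))
  (GRing.isMonoidMorphism.Build _ _ t (can2_monoid_morphism sK tK)).
apply: (@u_polynomial_aut _ _ _ _ _ _ _ _ _ _ s t') => //.
by rewrite eps_p_prod eps_m_prod.
Qed.
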